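(* Let $(F_n)_{n\in\omega}$ be a sequence of nonempty finite subsets of $\omega$ such that $\lim_{n\to\infty}|F_n|=\infty$, and let $$\mathcal{I}(\mathscr{F}):=\left\{A\subseteq\omega : \frac{|A\cap F_n|}{|F_n|}\to 0 \text{ as } n\to\infty\right\}.$$ Then $\mathcal{I}(\mathscr{F})$ is an analytic P-ideal.
   Context: $\omega$ denotes the set of nonnegative integers, and $\mathscr{F}=(F_n)$. An ideal on $\omega$ is a collection of subsets of $\omega$ closed under subsets and finite unions; it is assumed to be proper (it does not contain $\omega$) and admissible (it contains every finite subset of $\omega$). An ideal $\mathcal{I}$ is a P-ideal if it is $\sigma$-directed modulo finite sets: for every sequence $(A_k)$ of elements of $\mathcal{I}$ there is $A\in\mathcal{I}$ such that $A_k\setminus A$ is finite for every $k$. The power set $\mathcal{P}(\omega)$ is endowed with the Cantor-space topology, i.e. it is identified with $\{0,1\}^{\omega}$ with the product topology, and an ideal is analytic if it is an analytic subset of this space. *)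

(* Defs.v *)
From HB Require Import structures.
From mathcomp Require Import all_boot all_order all_algebra.
From mathcomp Require Import finmap.
From mathcomp Require Import all_classical all_reals all_analysis.

Set Implicit Arguments.
Unset Strict Implicit.
Unset Printing Implicit Defensive.

Import Order.TTheory GRing.Theory Num.Theory.
Import numFieldNormedType.Exports.

Local Open Scope classical_set_scope.
Local Open Scope ring_scope.

(* Ideals are proper and admissible. *)
Definition is_ideal (I : set (set nat)) : Prop :=
  [/\ forall A B : set nat, A `<=` B -> I B -> I A,
      forall A B : set nat, I A -> I B -> I (A `|` B),
      ~ I [set: nat]
    & forall A : set nat, finite_set A -> I A].

Definition is_P_ideal (I : set (set nat)) : Prop :=
  is_ideal I /\
  forall A : nat -> set nat, (forall k, I (A k)) ->
    exists2 B : set nat, I B & forall k, finite_set (A k `\` B).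

(* The topology on each factor [nat] is discrete. *)
Definition baire_space : topologicalType := prod_topology (fun _ : nat => nat).

(* Used for [X] Polish; the empty set is not an image of the Baire space, hence
   the separate case. *)
Definition analytic_set (X : topologicalType) (S : set X) : Prop :=
  S = set0 \/
  exists2 f : baire_space -> X, continuous f & range f = S.

(* A family of subsets of [nat], seen in the Cantor space by identifying a
   subset with its characteristic function. *)
Definition in_cantor (I : set (set nat)) : set cantor_space :=
  [set x : cantor_space | I [set n | x n]].

Definition analytic_ideal (I : set (set nat)) : Prop :=
  is_ideal I /\ analytic_set (in_cantor I).

Definition density_ideal (R : realType) (F : nat -> {fset nat}) :
    set (set nat) :=
  [set A : set nat |
    (fun n => #|` [fset x in F n | x \in A]%fset|%:R / #|` F n|%:R : R)
      @ \oo --> (0 : R)].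

(* Main.v *)
Require Import Defs.
From mathcomp Require Import all_boot all_order all_algebra.
From mathcomp Require Import finmap.
From mathcomp Require Import all_classical all_reals all_analysis.
Local Open Scope classical_set_scope.

(** Write [d n A] for the proportion of [F n] that lies in [A]; each [d n] is
    monotone and subadditive, and [A] belongs to the ideal when [d n A] tends
    to [0].  A finite set is in the ideal because the cardinals of the [F n]
    tend to infinity, and the whole of [nat] is not because each [F n] is
    nonempty, so that [d n] gives it the value [1].

    The P-property is a diagonal argument ([diagonal_cvg0]).  Let [C k] be the
    union of [A 0], ..., [A k].  Since [d n (C k)] tends to [0] for each [k],
    there is a function [kappa] that tends to infinity so slowly that
    [d n (C (kappa n))] still tends to [0].  The set [B] of the points that lie
    in [C (kappa n)] as soon as they lie in [F n] is then in the ideal, and a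
    point of [A k] outside [B] lies in some [F n] with [kappa n < k], hence in
    one of finitely many finite sets.

    For analyticity, the ideal is presented as the sets [A] whose tails
    [A `&` [m, oo[ ] have small [d n], uniformly in [n], for large [m]
    ([density_ideal_exhaustiveP]).  Such an [A] is described by a point of the
    Baire space coding [A] together with a function [Y], where the tail of [A]
    after [Y k] has all its [d n] at most [1 / (k + 1)].  An arbitrary code is
    made into a member of the ideal by deleting each point [m] at which one of
    these inequalities fails for the part of the set up to [m].  Whether [m]
    survives depends only on the first [m + 1] coordinates of the code, which
    gives a continuous map ([trim_continuous]) defined on the whole Baire
    space, with range exactly the ideal. *)

Section Density.
Set Implicit Arguments.
Unset Strict Implicit.
Import Order.TTheory GRing.Theory Num.Theory.
Import numFieldNormedType.Exports.
Local Open Scope ring_scope.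

(** * Null sequences *)

Section Sequences.
Variable R : realType.

Lemma cvg0_invnP (u : nat -> R) : (forall n, 0 <= u n) ->
  u @ \oo --> (0 : R) <-> forall k, \forall n \near \oo, u n <= k.+1%:R^-1.
Proof.
move=> u_ge0; split=> [/cvgrPdist_le u0 k|uk].
  have := u0 k.+1%:R^-1; rewrite invr_gt0 ltr0Sn => /(_ isT).
  by apply: filterS => n; rewrite sub0r normrN ger0_norm.
apply/cvgrPdist_le => e e0.
have [k _ /(_ _ (leqnn k)) /= ke] := near_infty_natSinv_lt (PosNum e0).
apply: filterS (uk k) => n ukn; rewrite sub0r normrN ger0_norm //.
exact: le_trans ukn (ltW ke).
Qed.

(** Take for [kappa n] the largest [k <= n] with [a k n <= 1 / (k + 1)]: every
    given [k] qualifies for large [n], so [kappa] tends to infinity and the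
    bound it satisfies tends to [0]. *)
Lemma diagonal_cvg0 (a : nat -> nat -> R) : (forall k n, 0 <= a k n) ->
    (forall k, a k @ \oo --> (0 : R)) ->
  exists2 kappa : nat -> nat, kappa @ \oo --> \oo &
    (fun n => a (kappa n) n) @ \oo --> (0 : R).
Proof.
move=> a_ge0 a0.
pose P n := [pred k : 'I_n.+1 | a k n <= k.+1%:R^-1].
pose kappa n := (\max_(k in P n) k)%N.
have kappaP K : \forall n \near \oo,
    (K <= kappa n)%N /\ a (kappa n) n <= K.+1%:R^-1.
  have /cvg0_invnP /(_ K) aK := a0 K.
  near=> n.
  have Kn : (K < n.+1)%N by rewrite ltnS; near: n; exact: nbhs_infty_ge.
  have PK : Ordinal Kn \in P n by rewrite inE /=; near: n; exact: aK.
  have le_K : (K <= kappa n)%N by exact: (leq_bigmax_cond (Ordinal Kn)).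
  split=> //; have P0 : (0 < #|P n|)%N by apply/card_gt0P; exists (Ordinal Kn).
  have [i Pi kE] := eq_bigmax_cond (fun k : 'I_n.+1 => k : nat) P0.
  move: le_K; rewrite /kappa kE => le_K; apply: le_trans Pi _.
  by rewrite lef_pV2 ?posrE ?ltr0Sn// ler_nat ltnS.
exists kappa.
  apply/cvgnyPge => K; apply: filterS (kappaP K) => n [] //.
by apply/cvg0_invnP => // K; apply: filterS (kappaP K) => n [].
Unshelve. all: by end_near. Qed.

End Sequences.

(** * The density ideal *)

Section DensityIdeal.
Variables (R : realType) (F : nat -> {fset nat}).
Implicit Types A B : set nat.

Definition density n A : R :=
  #|` [fset x in F n | x \in A]%fset|%:R / #|` F n|%:R.

Lemma density_ge0 n A : 0 <= density n A.
Proof. by rewrite divr_ge0. Qed.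

Lemma le_density n A B : (forall x, x \in F n -> A x -> B x) ->
  density n A <= density n B.
Proof.
move=> AB; rewrite ler_wpM2r// ler_nat fsubset_leq_card//.
apply/fsubsetP => x; rewrite !inE /= => /andP[xF]; rewrite xF /= !in_setE.
exact: AB.
Qed.

Lemma densityU n A B : density n (A `|` B) <= density n A + density n B.
Proof.
rewrite /density -mulrDl ler_wpM2r// -natrD ler_nat.
apply: leq_trans (leq_card_fsetU _ _); apply: fsubset_leq_card.
by apply/fsubsetP => x; rewrite !inE /= in_setU => /andP[->].
Qed.

Lemma density_idealP A : density_ideal R F A <->
  forall k, \forall n \near \oo, density n A <= k.+1%:R^-1.
Proof. by apply: cvg0_invnP => n; exact: density_ge0. Qed.

Lemma density_set0 n : density n set0 = 0.
Proof.
rewrite /density (_ : [fset x in F n | x \in set0]%fset = fset0).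
  by rewrite cardfs0 mul0r.
by apply/fsetP => x; rewrite !inE /= in_set0 andbF.
Qed.

Hypotheses (F_neq0 : forall n, F n <> fset0)
  (F_oo : (fun n => #|` F n|) @ \oo --> \oo).

Lemma densityT n : density n setT = 1.
Proof.
rewrite /density (_ : [fset x in F n | x \in setT]%fset = F n).
  by rewrite divff// pnatr_eq0 cardfs_eq0; exact/eqP.
by apply/fsetP => x; rewrite !inE /= in_setT andbT.
Qed.

Lemma density_ideal_finite A : finite_set A -> density_ideal R F A.
Proof.
move=> finA; apply/density_idealP => k.
have /cvgnyPge /(_ (#|` fset_set A| * k.+1)%N) := F_oo.
apply: filterS => n leF.
have F_gt0 : (0 < #|` F n|)%N by rewrite cardfs_gt0; exact/eqP.
rewrite /density ler_pdivrMr ?ltr0n// mulrC ler_pdivlMr ?ltr0Sn//.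
rewrite -natrM ler_nat; apply: leq_trans leF.
rewrite leq_mul2r/= fsubset_leq_card//.
by apply/fsubsetP => x; rewrite !inE /= in_fset_set// => /andP[].
Qed.

Lemma density_ideal_is_ideal : is_ideal (density_ideal R F).
Proof.
split.
- move=> A B AB /density_idealP IB; apply/density_idealP => k.
  apply: filterS (IB k) => n; apply: le_trans.
  by apply: le_density => x _; exact: AB.
- move=> A B IA IB.
  apply: (@squeeze_cvgr _ _ _ _ (fun=> 0) (fun n => density n A + density n B)).
  + apply: nearW => n; apply/andP.
    by split; [exact: density_ge0|exact: densityU].
  + exact: cvg_cst.
  + by rewrite -[X in _ --> X]addr0; exact: cvgD.
- move=> /density_idealP /(_ 1%N) [N _ /(_ N (leqnn N)) /=].
  by rewrite densityT invf_ge1// lern1.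
- exact: density_ideal_finite.
Qed.

Lemma bounded_prefix N :
  exists m, forall n x, (n < N)%N -> x \in F n -> (x < m)%N.
Proof.
exists (\max_(n < N) \max_(x <- F n) x).+1 => n x nN xF.
rewrite ltnS; apply: leq_trans (leq_bigmax (Ordinal nN)).
rewrite /=. exact: (@leq_bigmax_seq _ _ xpredT id).
Qed.

(** * The P-property *)

Lemma density_ideal_P_ideal : is_P_ideal (density_ideal R F).
Proof.
have [_ IU _ _] := density_ideal_is_ideal.
split=> [|A IA]; first exact: density_ideal_is_ideal.
pose C k := [set x | exists2 j, (j <= k)%N & A j x].
have IC k : density_ideal R F (C k).
  elim: k => [|k IH].
    suff -> : C 0%N = A 0%N by [].
    by apply/seteqP; split=> [x [j]|x ?]; [rewrite leqn0 => /eqP ->|exists 0%N].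
  suff -> : C k.+1 = C k `|` A k.+1 by exact: IU.
  apply/seteqP; split=> x [].
  - move=> j; rewrite leq_eqVlt => /orP[/eqP ->|jk] Ax; first by right.
    by left; exists j.
  - by case=> j jk Ax; exists j => //; exact: leqW.
  - by move=> Ax; exists k.+1.
(* The points outside every F n belong to B, vacuously. *)
have [kappa kappa_oo d0] := diagonal_cvg0 (fun k n => density_ge0 n (C k)) IC.
pose B := [set x | forall n, x \in F n -> C (kappa n) x].
exists B.
  apply/density_idealP => k.
  have /cvg0_invnP /(_ k) := d0.
  move=> /(_ (fun n => density_ge0 n _)); apply: filterS => n.
  by apply: le_trans; apply: le_density => x xF; exact.
move=> k; have /cvgnyPge /(_ k) [N _ kN] := kappa_oo.
have [m Fm] := bounded_prefix N.
apply: (sub_finite_set _ (finite_II m)) => x [Ax /existsNP[n /not_implyP[xF nC]]].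
apply: Fm xF; rewrite ltnNge; apply/negP => Nn; apply: nC.
by exists k => //; exact: kN.
Qed.

(** * Analyticity *)

(** If [d n A] is small for [n >= N], it suffices to choose [m] above the
    finite sets [F n] with [n < N].  Conversely the initial segment of [A]
    below [m] is finite and so has density tending to [0]. *)
Lemma density_ideal_exhaustiveP A : density_ideal R F A <->
  forall k, exists m, forall n,
    density n (A `&` [set x | (m <= x)%N]) <= k.+1%:R^-1.
Proof.
split=> [/density_idealP IA k|exA].
  have [N _ leN] := IA k; have [m Fm] := bounded_prefix N.
  exists m => n; have [Nn|nN] := leqP N n.
    by apply: le_trans (leN n Nn); apply: le_density => x _ [].
  apply: (@le_trans _ _ (density n set0)); last by rewrite density_set0 invr_ge0.
  apply: le_density => x xF [_ /=].
  by rewrite leqNgt (Fm n).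
(* 1 / (k + 1) is split into two halves, one for each part of A. *)
apply/density_idealP => k; have [m Am] := exA (k.*2.+1).
have /density_idealP/(_ k.*2.+1) := density_ideal_finite (finite_II m).
apply: filterS => n fin_m.
apply: (@le_trans _ _ (density n (`I_m `|` A `&` [set x | (m <= x)%N]))).
  apply: le_density => x _ Ax /=.
  by have [mx|xm] := leqP m x; [right|left].
apply: le_trans (densityU _ _ _) _.
apply: le_trans (lerD fin_m (Am n)) _.
have -> : k.*2.+2%:R = 2 * k.+1%:R :> R by rewrite -natrM mul2n doubleS.
by rewrite invfM -mulrDl -[2^-1]mul1r -splitr mul1r.
Qed.

(** The parity of [z i] tells whether [i] is in the coded set, and the halves of
    the coordinates code the function [Y k = (z k)./2 + k].  The summand [k]
    makes every value [Y k <= m] depend only on coordinates up to [m], and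
    leaves only finitely many [k] to test at [m]. *)
Definition coded_segment (z : baire_space) k m : set nat :=
  [set i | odd (z i) /\ ((z k)./2 + k <= i <= m)%N].

(** The inequalities are tested on the coded set itself, not on what survives in
    it, so no recursion is involved: once an inequality fails at a point, it
    fails at all later ones. *)
Definition trim (z : baire_space) : cantor_space := fun m =>
  odd (z m) && `[< forall k n, ((z k)./2 + k <= m)%N ->
                     density n (coded_segment z k m) <= k.+1%:R^-1 >].

Lemma trim_local (z w : baire_space) m : (forall i, (i <= m)%N -> w i = z i) ->
  trim w m = trim z m.
Proof.
move=> zw; rewrite /trim zw//; congr (_ && _).
have seg k : (k <= m)%N -> coded_segment w k m = coded_segment z k m.
  move=> km; apply/seteqP; split=> i [oi Yi]; have /andP[_ im] := Yi.
    by move: oi Yi; rewrite /coded_segment /= !zw.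
  by move: oi Yi; rewrite /coded_segment /= !zw.
have km y k : (y + k <= m)%N -> (k <= m)%N by apply: leq_trans; exact: leq_addl.
apply: asbool_equiv_eq; split=> H k n Ym; have lkm := km _ _ Ym.
  by rewrite -seg//; apply: H; rewrite zw.
by rewrite seg//; apply: H; rewrite -zw.
Qed.

Lemma trim_continuous : continuous trim.
Proof.
move=> z; apply/pointwise_cvgP => m.
apply/discrete_cvg; rewrite nbhs_simpl /=.
have near_eq i : \forall w \near z, (w : baire_space) i = z i.
  exact: (@proj_continuous nat (fun=> nat) i z _ (discrete_set1 (z i))).
have : \forall w \near z, forall i : 'I_m.+1, (w : baire_space) i = z i.
  apply: (@filter_forall _ _ (fun (i : 'I_m.+1) (w : baire_space) => w i = z i)
    _ (nbhs_filter z)) => i.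
  exact: near_eq.
apply: filterS => w wz; apply: trim_local => i im.
exact: (wz (Ordinal (im : (i < m.+1)%N))).
Qed.

(** For given [k] and [n], let [m] be the last surviving point of [F n] beyond
    [Y k].  All the surviving points of [F n] beyond [Y k] are in the segment
    tested at [m], whose density is at most [1 / (k + 1)] since [m] survived. *)
Lemma density_ideal_trim (z : baire_space) :
  density_ideal R F [set m | trim z m].
Proof.
apply/density_ideal_exhaustiveP => k; exists ((z k)./2 + k)%N => n.
set T := _ `&` _.
have [T0|] := eqVneq [fset x in F n | x \in T]%fset fset0.
  by rewrite /density T0 cardfs0 mul0r invr_ge0.
move=> /(unstable.fset_nat_maximum id)[m []].
rewrite !inE /= => /andP[mF]; rewrite in_setE => -[/andP[_ /asboolP Hm] Ym] maxm.
apply: le_trans (Hm k n Ym); apply: le_density => x xF xT.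
have [/andP[ox _] Yx] := xT; split=> //; rewrite Yx/=.
by apply: maxm; rewrite !inE /= xF in_setE.
Qed.

(** A code with the right function [Y] makes every test succeed, so that
    nothing is deleted. *)
Lemma trim_surj A : density_ideal R F A ->
  exists z : baire_space, [set m | trim z m] = A.
Proof.
move=> /density_ideal_exhaustiveP /choice[Y AY].
pose z : baire_space := fun k => ((k \in A) + (Y k).*2)%N.
have oz k : odd (z k) = (k \in A) by rewrite oddD odd_double addbF oddb.
have hz k : (z k)./2 = Y k by rewrite /z half_bit_double.
exists z; apply/seteqP; split=> m /=.
  by move=> /andP[]; rewrite oz in_setE.
move=> Am; apply/andP; split; first by rewrite oz in_setE.
apply/asboolP => k n _; apply: le_trans (AY k n).
apply: le_density => i _ [] /=; rewrite oz hz in_setE => Ai /andP[Yi _].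
by split=> //=; exact: leq_trans (leq_addr _ _) Yi.
Qed.

Lemma density_ideal_analytic : analytic_ideal (density_ideal R F).
Proof.
split; first exact: density_ideal_is_ideal.
right; exists trim; first exact: trim_continuous.
apply/seteqP; split=> [_ [z _ <-]|x Ix]; first exact: density_ideal_trim.
have [z zx] := trim_surj Ix; exists z => //.
apply/funext => m; apply/idP/idP => [zm|xm].
  by move: zm; rewrite -[is_true (trim z m)]/([set m | trim z m] m) zx.
by rewrite -[is_true (trim z m)]/([set m | trim z m] m) zx.
Qed.

End DensityIdeal.
End Density.

Theorem mainTheorem3 (R : realType) (F : nat -> {fset nat})
  (F_neq0 : forall n : nat, F n <> fset0)
  (F_oo : (fun n : nat => #|` F n|) @ \oo --> \oo) :
  is_P_ideal (density_ideal R F) /\ analytic_ideal (density_ideal R F).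
Proof.
by split; [exact: density_ideal_P_ideal|exact: density_ideal_analytic].
Qed.
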